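(* Let $N=2n\geq4$ be even, $\omega=\exp(2\pi i/N)$, and let $u\in\mathbb{C}$ with $u\neq0$, $u^N\neq1$. With the notation of the context, $E=\mathbb{C}^N$ (identified with $\mathcal R$), $R=t$, $\sigma=s$ and $F_r=\mathcal K_r$ ($0\leq r\leq n$) form a length-$n$ Chebyshev-filtered datum over $\mathbb{C}$. With the invertible matrix $S=\begin{pmatrix}I&I\\-I&0\end{pmatrix}$, the associated operators $\Theta,\Xi$ are the conjugates of $T,\Lambda$: $\Theta=S^{-1}TS$ and $\Xi=S^{-1}\Lambda S$. Thus one recovers: $\Lambda T^{k_1}\Lambda\cdots T^{k_M}\Lambda=0$ for all $M\geq n$ and all $(k_1,\ldots,k_M)\in\mathbb{Z}^M$, $(\Lambda T)^{n-1}\Lambda\neq0$, and, for the unital algebra $A$ generated by $T,\Lambda$ and $J=A\Lambda A$, $J=\operatorname{Jac}(A)$, $J^n\neq0$, $J^{n+1}=0$.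
   Context: Index the standard basis of $\mathbb{C}^N$ by $j\in\mathbb{Z}/N\mathbb{Z}$ (writing $\epsilon_j$) and define $t\epsilon_j=\epsilon_{j-1}$, $d\epsilon_j=\omega^j\epsilon_j$. For $u\neq0$, $u^N\neq1$, the operator $ud-u^{-1}d^{-1}$ is invertible; put $s=(ud-u^{-1}d^{-1})^{-1}$ and, on $\mathbb{C}^{2N}=\mathbb{C}^N\oplus\mathbb{C}^N$, $$T=\begin{pmatrix}t&0\\0&t^{-1}\end{pmatrix},\qquad \Lambda=\begin{pmatrix}s&s\\-s&-s\end{pmatrix}.$$ Cyclic model: $\mathcal R=\mathbb{C}[z,z^{-1}]/(z^N-1)$ is identified with $\mathbb{C}^N$ by evaluation $f\mapsto(f(\omega^j))_j$; then $d$ is multiplication by $z$ and $(tf)(z)=f(\omega z)$. Put $x=uz+u^{-1}z^{-1}$, $\rho=z^n$ in $\mathcal R$, and $\mathcal K_m=\operatorname{span}_{\mathbb{C}}\{x^r,\rho x^r:0\leq r<m\}$ for $0\leq m\leq n$. Definition. Let $\Bbbk$ be a field, $E$ a finite-dimensional $\Bbbk$-vector space, $n\geq2$, and $R,\sigma\in\operatorname{GL}(E)$. Set $C=R+R^{-1}$, $D=\sigma(R-R^{-1})$, and, on $E\oplus E$, $$\Theta=\begin{pmatrix}R^{-1}&0\\ R-R^{-1}&R\end{pmatrix},\qquad \Xi=\begin{pmatrix}0&\sigma\\0&0\end{pmatrix}.$$ $(E,R,\sigma,F_\bullet)$ is a length-$n$ Chebyshev-filtered datum if $F_\bullet$ is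 a flag $0=F_0\subset F_1\subset\cdots\subset F_n=E$ such that: (H1) $CF_r\subseteq F_r$ for $1\leq r\leq n$; (H2) $DF_r\subseteq F_{r-1}$ for $1\leq r\leq n$; (H3) $D^{\,n-1}\neq0$; (H4) $\Bbbk[\Theta,\Theta^{-1}]$ is semisimple. *)

(* Defs.v *)
From HB Require Import structures.
From mathcomp Require Import all_boot all_order all_algebra.
From mathcomp Require Import complex classical_sets reals trigo.

Set Implicit Arguments.
Unset Strict Implicit.
Unset Printing Implicit Defensive.

Import Order.TTheory GRing.Theory Num.Theory.

Local Open Scope classical_set_scope.
Local Open Scope ring_scope.

(* Algebras of operators on a finite-dimensional space V, as sets of          *)
(* endomorphisms.  Products are always written with [\o]: MathComp leaves     *)
(* 'End(V) without a canonical product, and the optional one of FalgLfun is   *)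
(* the opposite of composition.                                               *)
Section OperatorAlgebras.
Variables (K : fieldType) (V : vectType K).
Implicit Types (f : 'End(V)) (A I L X Y J : set 'End(V)).

Definition lfun_exp f (k : nat) : 'End(V) := iter k (comp_lfun f) \1%VF.

Definition lfun_expz f (k : int) : 'End(V) :=
  match k with Posz m => lfun_exp f m | Negz m => lfun_exp (f^-1)%VF m.+1 end.

Definition unital_subalgebra A : Prop :=
  [/\ A \1%VF,
      forall (c : K) a b, A a -> A b -> A (c *: a + b)
    & forall a b, A a -> A b -> A (a \o b)%VF].

Definition generated_algebra X : set 'End(V) :=
  [set a | forall A, unital_subalgebra A -> X `<=` A -> A a].

Definition left_ideal A I : Prop :=
  [/\ I `<=` A, I 0, forall a b, I a -> I b -> I (a - b)
    & forall a b, A a -> I b -> I (a \o b)%VF].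

Definition maximal_left_ideal A I : Prop :=
  [/\ left_ideal A I, I <> A
    & forall L, left_ideal A L -> I `<=` L -> L <> A -> L = I].

Definition minimal_left_ideal A I : Prop :=
  [/\ left_ideal A I, I <> [set 0]
    & forall L, left_ideal A L -> L `<=` I -> L <> [set 0] -> L = I].

Definition Jac A : set 'End(V) :=
  [set a | A a /\ forall I, maximal_left_ideal A I -> I a].

(* The left regular module of A is the direct sum of simple submodules; since *)
(* A is unital, a direct sum decomposition of it has finitely many terms.     *)
Definition semisimple_algebra A : Prop :=
  exists k (I : 'I_k -> set 'End(V)),
    (forall i, minimal_left_ideal A (I i)) /\
    (forall a, A a -> exists! x : {ffun 'I_k -> 'End(V)},
       (forall i, I i (x i)) /\ a = \sum_i x i).

Definition product_span X Y : set 'End(V) :=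
  [set c | exists k (x y : 'I_k -> 'End(V)),
     [/\ forall i, X (x i), forall i, Y (y i)
       & c = \sum_(i < k) (x i \o y i)%VF]].

Definition ideal_generated_by A f : set 'End(V) :=
  product_span (product_span A [set f]) A.

(* J^0 = A and J^(k+1) = J J^k. *)
Definition ideal_exp A J (k : nat) : set 'End(V) := iter k (product_span J) A.

(* f g^(k_1) f ... g^(k_M) f *)
Definition word f g (ks : seq int) : 'End(V) :=
  foldr (fun k w => f \o (lfun_expz g k \o w))%VF f ks.

End OperatorAlgebras.

Section ChebyshevFilteredData.
Variables (K : fieldType) (E : vectType K).
Implicit Types (R sigma : 'End(E)).

(* The operator of matrix [[a, b], [c, d]] on E (+) E. *)
Definition block_fun (a b c d : 'End(E)) (x : E * E) : E * E :=
  (a x.1 + b x.2, c x.1 + d x.2).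

Definition block_lfun (a b c d : 'End(E)) : 'End((E * E)%type) :=
  linfun (block_fun a b c d).

Lemma block_lfunE a b c d x :
  block_lfun a b c d x = (a x.1 + b x.2, c x.1 + d x.2).
Proof.
have lin : linear (block_fun a b c d).
  move=> k u v; rewrite /block_fun; congr pair => /=;
    by rewrite !linearP scalerDr addrACA.
pose L := GRing.isLinear.Build K (E * E)%type (E * E)%type _
  (block_fun a b c d) lin.
pose g : {linear (E * E)%type -> (E * E)%type} :=
  HB.pack (block_fun a b c d) L.
exact: (lfunE g x).
Qed.

Definition Theta R : 'End((E * E)%type) :=
  block_lfun (R^-1)%VF 0 (R - (R^-1)%VF) R.

Definition Xi sigma : 'End((E * E)%type) := block_lfun 0 sigma 0 0.

Definition Cop R : 'End(E) := R + (R^-1)%VF.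

Definition Dop R sigma : 'End(E) := (sigma \o (R - (R^-1)%VF))%VF.

(* Only F 0, ..., F n are constrained. *)
Definition flag (n : nat) (F : nat -> {vspace E}) : Prop :=
  [/\ F 0%N = 0%VS, F n = fullv
    & forall r, (r < n)%N -> (F r <= F r.+1)%VS /\ F r <> F r.+1].

Definition chebyshev_filtered_datum (n : nat) (R sigma : 'End(E))
    (F : nat -> {vspace E}) : Prop :=
  [/\ (2 <= n)%N, bijective R, bijective sigma & flag n F] /\
  [/\ forall r, (1 <= r <= n)%N -> (Cop R @: F r <= F r)%VS,
      forall r, (1 <= r <= n)%N -> (Dop R sigma @: F r <= F r.-1)%VS,
      lfun_exp (Dop R sigma) n.-1 <> 0
    & semisimple_algebra
        (generated_algebra [set Theta R; ((Theta R)^-1)%VF])].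

End ChebyshevFilteredData.

Section CyclicModel.
Variables (R : realType) (N : nat) (u : R[i]).
Local Notation C := R[i].

(* exp(2 pi i / N) *)
Definition omega : C :=
  (cos (2 * pi / N%:R) +i* sin (2 * pi / N%:R))%C.

(* The index set Z/NZ is 'I_N, on which [ord_pred] is j |-> j - 1 mod N;      *)
(* column j of the matrix is the image of the j-th basis vector.              *)
Definition t_op : 'End('cV[C]_N) :=
  linfun (mulmx (\matrix_(i, j < N) (i == ord_pred j)%:R)).

Definition d_op : 'End('cV[C]_N) :=
  linfun (mulmx (diag_mx (\row_(j < N) omega ^+ j))).

Definition s_op : 'End('cV[C]_N) :=
  ((u *: d_op - u^-1 *: (d_op^-1)%VF)%R^-1)%VF.

Definition T_op : 'End(('cV[C]_N * 'cV[C]_N)%type) :=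
  block_lfun t_op 0 0 (t_op^-1)%VF.

Definition Lambda_op : 'End(('cV[C]_N * 'cV[C]_N)%type) :=
  block_lfun s_op s_op (- s_op) (- s_op).

Definition S_op : 'End(('cV[C]_N * 'cV[C]_N)%type) :=
  block_lfun \1%VF \1%VF (- \1%VF) 0.

(* C[z, z^-1] / (z^N - 1) is C[z] / (z^N - 1) for N > 0: z = 'qX is already   *)
(* invertible in the latter.                                                  *)
Local Notation cyclic_ring := {poly %/ ('X^N - 1 : {poly C})}.

Definition ev (f : cyclic_ring) : 'cV[C]_N :=
  \col_(j < N) (f : {poly C}).[omega ^+ j].

Definition x_elt : cyclic_ring := u *: 'qX + u^-1 *: 'qX^-1.

Definition rho_elt (n : nat) : cyclic_ring := 'qX ^+ n.

(* K_m, transported to C^N by the evaluation isomorphism. *)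
Definition K_space (n m : nat) : {vspace 'cV[C]_N} :=
  <<[seq ev (x_elt ^+ r) | r <- iota 0 m] ++
    [seq ev (rho_elt n * x_elt ^+ r) | r <- iota 0 m]>>%VS.

End CyclicModel.

(* Main.v *)
(* Put x_j = u w^j + u^-1 w^-j and y_j = u w^j - u^-1 w^-j, so that           *)
(* y_j^2 = x_j^2 - 4 and s is multiplication by 1 / y_j.  The shifts t, t^-1  *)
(* send x to a x +- b y with a, b = (w +- w^-1) / 2, and rho to - rho; hence  *)
(* C x^r and D x^r are polynomials in x, of degree at most r and r - 1, and   *)
(* D x^r has leading coefficient w^r - w^-r <> 0 for 0 < r < n.  This gives   *)
(* D^(n-1) x^(n-1) <> 0, and strictness of the flag: D^r kills K_r but not    *)
(* x^r.  The last step K_n is everything, because x is injective on each      *)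
(* parity class of indices, where rho = +-1.                                  *)
(*                                                                            *)
(* As s (t^k - t^-k) maps K_(r+1) into K_r for every k, the subspaces         *)
(* {v | s (t^k v_1 + t^-k v_2) \in K_r for all k} are T-stable and are moved  *)
(* down one step by Lambda; so J^(n+1) and all the long words vanish.  Since  *)
(* T^N = 1, A is the sum of J and the span of the eigenprojections of T;      *)
(* therefore the nilpotent ideal J is the Jacobson radical.                   *)

Require Import Defs.
From HB Require Import structures.
From mathcomp Require Import all_boot all_order all_algebra.
From mathcomp Require Import complex classical_sets reals trigo.
From mathcomp Require Import boolp qpoly ring lra zify.

Set Implicit Arguments.
Unset Strict Implicit.
Unset Printing Implicit Defensive.

Import Order.TTheory GRing.Theory Num.Theory.

Local Open Scope classical_set_scope.
Local Open Scope ring_scope.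

(** * Operator algebras *)

(** In the evaluation picture t moves indices, d is multiplication by w^j and s is division by y_j.
    The assumption u^N != 1 enters only through [uomega_sqr_neq1]: it makes every y_j nonzero and
    makes x injective on the even and on the odd indices.

    Since y^2 = x^2 - 4, the values of t x and t^-1 x are conjugate over the polynomials in x: a x +
    b y and a x - b y. So (t + t^-1) x^r is even in y, hence a polynomial in x, and (t - t^-1) x^r
    is odd in y, hence y times a polynomial, and s removes that factor ([cheb_horner], [size_cheb]).
    Multiplying by rho only adds a sign. This gives (H1) and (H2). The leading coefficients
    ([cheb_lead]) give D^r x^r != 0 for r < n ([DopX_neq0]), whence (H3) and the strictness of the
    flag. Interpolation on each parity class gives K_n = E ([K_space_full]). Finally Theta^N = 1 and
    w is a primitive N-th root of unity, so the algebra of Theta is spanned by orthogonal spectral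
    projections ([semisimple_root_of_unity]).

    For the consequences, E + E carries a filtration [filt] with n + 1 steps, preserved by A and
    lowered by J ([filt_A], [filt_J]); this kills J^(n+1) and the long words. On vectors (e, -e) the
    operator Lambda T acts as D, so (Lambda T)^(n-1) Lambda inherits non-vanishing from D^(n-1).
    Modulo the nil ideal J, the algebra A is spanned by the spectral projections of T, orthogonal
    idempotents outside J; so A/J is a product of copies of the field and J is the radical
    ([Jac_nil_ideal]). *)

Section Operators.
Variables (K : fieldType) (V : vectType K).
Implicit Types (f g P : 'End(V)) (A I J X Y : set 'End(V)).

Lemma cancel_lker0 f (g : V -> V) : cancel f g -> lker f == 0%VS.
Proof. by move=> /can_inj fI; apply/lker0P. Qed.

Lemma lfun_invE f (g : V -> V) : cancel f g -> cancel g f -> (f^-1)%VF =1 g.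
Proof.
by move=> fK gK v; rewrite -{1}(gK v) lker0_lfunK ?(cancel_lker0 fK).
Qed.

Lemma comp_lfun_suml (I : finType) (F : I -> 'End(V)) g :
  ((\sum_i F i) \o g = \sum_i (F i \o g))%VF.
Proof.
by apply/lfunP => v; rewrite !(comp_lfunE, sum_lfunE);
   apply: eq_bigr => i _; rewrite comp_lfunE.
Qed.

Lemma comp_lfun_sumr (I : finType) g (F : I -> 'End(V)) :
  (g \o (\sum_i F i) = \sum_i (g \o F i))%VF.
Proof.
by apply/lfunP => v; rewrite !(comp_lfunE, sum_lfunE) linear_sum;
   apply: eq_bigr => i _; rewrite comp_lfunE.
Qed.

Lemma lfun_expS f k : lfun_exp f k.+1 = (f \o lfun_exp f k)%VF.
Proof. by []. Qed.

Lemma lfun_expSr f k : lfun_exp f k.+1 = (lfun_exp f k \o f)%VF.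
Proof.
elim: k => [|k IH]; first by rewrite lfun_expS /= comp_lfun1l comp_lfun1r.
by rewrite lfun_expS {1}IH comp_lfunA -lfun_expS.
Qed.

Lemma lfun_expE f k v : lfun_exp f k v = iter k f v.
Proof.
by elim: k => [|k IH]; rewrite ?lfun_expS ?comp_lfunE ?IH // id_lfunE.
Qed.

(** Puts the inverse of an operator of finite order into every algebra that contains the
    operator. *)
Lemma lfun_exp_inv P m : lfun_exp P m.+1 = \1%VF -> (P^-1)%VF = lfun_exp P m.
Proof.
move=> PN; apply/lfunP; apply: lfun_invE => v.
  by rewrite -comp_lfunE -lfun_expSr PN id_lfunE.
by rewrite -comp_lfunE -lfun_expS PN id_lfunE.
Qed.

Lemma left_idealD A I f g : left_ideal A I -> I f -> I g -> I (f + g).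
Proof.
case=> _ I0 IB _ If Ig; have -> : f + g = f - (0 - g) by rewrite sub0r opprK.
by apply: (IB) => //; apply: IB.
Qed.

Section Subalgebra.
Variable A : set 'End(V).
Hypothesis A_alg : unital_subalgebra A.

Lemma subalg1 : A \1%VF. Proof. by case: A_alg. Qed.

Lemma subalgM f g : A f -> A g -> A (f \o g)%VF.
Proof. by case: A_alg => _ _; apply. Qed.

Lemma subalg0 : A 0.
Proof. by case: A_alg => A1 AL _; rewrite -(addNr \1%VF) -scaleN1r; apply: AL. Qed.

Lemma subalgZ c f : A f -> A (c *: f).
Proof.
by case: A_alg => _ AL _ Af; rewrite -[_ *: _]addr0; apply: AL => //; apply: subalg0.
Qed.

Lemma subalgD f g : A f -> A g -> A (f + g).
Proof. by case: A_alg => _ AL _ Af; rewrite -[f]scale1r; apply: AL. Qed.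

Lemma subalgB f g : A f -> A g -> A (f - g).
Proof. by move=> Af Ag; rewrite -scaleN1r; apply: subalgD => //; apply: subalgZ. Qed.

Lemma subalg_sum (I : finType) (F : I -> 'End(V)) :
  (forall i, A (F i)) -> A (\sum_i F i).
Proof.
by move=> AF; elim/big_ind: _ => //; [apply: subalg0 | apply: subalgD].
Qed.

Lemma subalgX f k : A f -> A (lfun_exp f k).
Proof. by move=> Af; elim: k => [|k IH]; [apply: subalg1 | apply: subalgM]. Qed.

End Subalgebra.

Lemma generated_subalgebra X : unital_subalgebra (generated_algebra X).
Proof.
split=> [B HB _|c a b Aa Ab B HB XB|a b Aa Ab B HB XB]; first exact: subalg1.
  by apply: (subalgD HB); [apply: (subalgZ HB); apply: Aa | apply: Ab].
by apply: (subalgM HB); [apply: Aa | apply: Ab].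
Qed.

Lemma sub_generated X : X `<=` generated_algebra X.
Proof. by move=> a Xa B _; apply. Qed.

Lemma product_span_mul X Y a b : X a -> Y b -> product_span X Y (a \o b)%VF.
Proof.
by move=> Xa Yb; exists 1%N, (fun=> a), (fun=> b); split=> //; rewrite big_ord1.
Qed.

Lemma product_span_add X Y a b :
  product_span X Y a -> product_span X Y b -> product_span X Y (a + b).
Proof.
move=> [k [x [y [Xx Yy ->]]]] [l [x' [y' [Xx' Yy' ->]]]].
exists (k + l)%N.
exists (fun i => match split i with inl i => x i | inr i => x' i end).
exists (fun i => match split i with inl i => y i | inr i => y' i end).
split=> [i|i|]; [by case: split | by case: split |].
rewrite big_split_ord /=; congr (_ + _); apply: eq_bigr => i _.
  by have := unsplitK (inl i : 'I_k + 'I_l) => /= ->.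
by have := unsplitK (inr i : 'I_k + 'I_l) => /= ->.
Qed.

Lemma product_span_sub X Y I : I 0 -> (forall a b, I a -> I b -> I (a + b)) ->
  (forall a b, X a -> Y b -> I (a \o b)%VF) -> product_span X Y `<=` I.
Proof.
move=> I0 ID IM _ [k [x [y [Xx Yy ->]]]].
by elim/big_ind: _ => // i _; apply: IM.
Qed.

Lemma product_span_mull X Y c : (forall a, X a -> X (c \o a)%VF) ->
  forall a, product_span X Y a -> product_span X Y (c \o a)%VF.
Proof.
move=> Xc _ [k [x [y [Xx Yy ->]]]]; exists k, (fun i => c \o x i)%VF, y.
by split=> // [i|]; [apply: Xc | rewrite comp_lfun_sumr; under eq_bigr do rewrite comp_lfunA].
Qed.

Lemma product_span_mulr X Y c : (forall a, Y a -> Y (a \o c)%VF) ->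
  forall a, product_span X Y a -> product_span X Y (a \o c)%VF.
Proof.
move=> Yc _ [k [x [y [Xx Yy ->]]]]; exists k, x, (fun i => y i \o c)%VF.
by split=> // [i|]; [apply: Yc | rewrite comp_lfun_suml; under eq_bigr do rewrite -comp_lfunA].
Qed.

Lemma left_ideal_product_span A X Y : unital_subalgebra A -> X 0 -> Y 0 ->
  (forall a b, A a -> X b -> X (a \o b)%VF) -> product_span X Y `<=` A ->
  left_ideal A (product_span X Y).
Proof.
move=> A_alg X0 Y0 XM sA.
have IM a b : A a -> product_span X Y b -> product_span X Y (a \o b)%VF.
  by move=> Aa; apply: product_span_mull => c; apply: XM.
split=> // [|a b Ia Ib]; first by have := product_span_mul X0 Y0; rewrite comp_lfun0l.
have -> : a - b = a + ((- \1) \o b)%VF by rewrite comp_lfunNl comp_lfun1l.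
apply: product_span_add => //; apply: IM => //.
by rewrite -scaleN1r; apply: subalgZ (subalg1 _).
Qed.

Section GeneratedIdeal.
Variables (A : set 'End(V)) (f : 'End(V)).
Hypotheses (A_alg : unital_subalgebra A) (Af : A f).
Let J := ideal_generated_by A f.

Lemma ideal_generated_by_gen : J f.
Proof.
rewrite -[f]comp_lfun1r -[(f \o _)%VF]comp_lfun1l comp_lfunA.
by apply: product_span_mul; [apply: product_span_mul|]; rewrite //=; apply: subalg1.
Qed.

Lemma ideal_generated_by_ind I : I 0 -> (forall a b, I a -> I b -> I (a + b)) ->
  (forall a b, A a -> A b -> I (a \o f \o b)%VF) -> J `<=` I.
Proof.
move=> I0 ID IM; apply: product_span_sub => // _ b [k [x [y [Ax Yy ->]]]] Ab.
by rewrite comp_lfun_suml; elim/big_ind: _ => // i _; rewrite Yy; apply: IM.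
Qed.

Lemma ideal_generated_by_left_ideal : left_ideal A J.
Proof.
have JA : J `<=` A.
  by apply: ideal_generated_by_ind => [|a b|a b Aa Ab]; rewrite -?comp_lfunA;
     [apply: subalg0 | apply: subalgD | do 2!apply: subalgM => //].
apply: left_ideal_product_span => //; last 2 first.
- exact: subalg0.
- by move=> a b Aa; apply: product_span_mull => c; apply: subalgM.
by rewrite -(comp_lfun0l V f); apply: product_span_mul => //; apply: subalg0.
Qed.

Lemma ideal_generated_by_mulr a b : J a -> A b -> J (a \o b)%VF.
Proof. by move=> Ja Ab; apply: product_span_mulr Ja => c Ac; apply: subalgM. Qed.

End GeneratedIdeal.

(** * The radical of an algebra spanned by orthogonal idempotents modulo a nil ideal *)

Section Jacobson.
Variables (A J : set 'End(V)) (N m : nat) (e : 'I_N -> 'End(V)).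
Hypotheses (A_alg : unital_subalgebra A) (J_ideal : left_ideal A J).
Hypothesis J_mulr : forall a b, J a -> A b -> J (a \o b)%VF.
Hypothesis J_nil : forall a, J a -> lfun_exp a m = 0.
Hypotheses (Ae : forall i, A (e i)) (e_neq0 : forall i, e i <> 0).
Hypothesis e_orth : forall i j, (e i \o e j)%VF = (i == j)%:R *: e j.
Hypothesis e_span : forall a, A a -> exists c : 'I_N -> K, J (a - \sum_i c i *: e i).

(** If a maximal left ideal I missed an element of J, then I + J would be all of A and 1 = y + z
    with y in I and z in J nilpotent; but then y = 1 - z is invertible in A, so I = A. *)
Lemma nil_ideal_sub_Jac : J `<=` Jac A.
Proof.
case: J_ideal => JA J0 JB JM a Ja; split=> [|I [[IA I0 IB IM] InA Imax]]; first exact: JA.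
pose L : set 'End(V) := [set x | exists y z, [/\ I y, J z & x = y + z]].
have L_ideal : left_ideal A L.
  split=> [_ [y [z [Iy Jz ->]]]||_ _ [y [z [Iy Jz ->]]] [y' [z' [Iy' Jz' ->]]]
          |b _ Ab [y [z [Iy Jz ->]]]].
  - by apply: subalgD; [|apply: IA|apply: JA].
  - by exists 0, 0; rewrite addr0.
  - exists (y - y'), (z - z'); split; [exact: IB|exact: JB|].
    by rewrite opprD addrACA.
  - exists (b \o y)%VF, (b \o z)%VF; split; [exact: IM|exact: JM|].
    by rewrite comp_lfunDr.
have IL : I `<=` L by move=> x Ix; exists x, 0; rewrite addr0.
have [LA|LA] := pselect (L = A); last first.
  by rewrite -(Imax L) //; exists 0, a; rewrite add0r.
have: L \1%VF by rewrite LA; apply: subalg1.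
case=> y [z [Iy Jz yz]]; case: InA; rewrite eqEsubset; split=> // b Ab.
(* The geometric series of z inverts y = 1 - z; it stops at [m] because z^m = 0. *)
have -> : b = (b \o (\sum_(k < m) lfun_exp z k \o y))%VF.
  have -> : y = \1%VF - z by rewrite yz addrK.
  rewrite comp_lfunDr comp_lfun1r comp_lfunNr comp_lfun_suml -sumrB.
  under eq_bigr do rewrite -lfun_expSr.
  rewrite -(big_mkord xpredT (fun k => lfun_exp z k - lfun_exp z k.+1)).
  rewrite -[X in (_ \o X)%VF]opprK -sumrN.
  under eq_bigr do rewrite opprB.
  by rewrite telescope_sumr // J_nil // sub0r opprK comp_lfun1r.
apply: (IM) => //; apply: (IM) => //; apply: subalg_sum => // k.
by apply: subalgX => //; apply: JA.
Qed.

(** Modulo J, an element a is a combination of the e_i, and e_i a is c_i e_i. An element of the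
    radical lies in every [M i], which forces each c_i to vanish. *)
Lemma Jac_sub_nil_ideal : Jac A `<=` J.
Proof.
case: (J_ideal) => JA J0 JB JM.
have JD := left_idealD J_ideal.
have JZ c x : J x -> J (c *: x).
  move=> Jx; rewrite -[x]comp_lfun1l comp_lfunZl; apply: JM => //.
  by apply: subalgZ (subalg1 _).
(* The powers of c e_i are c^k e_i, so nilpotency forces c = 0: no e_i lies in J. *)
have eJ i c : J (c *: e i) -> c = 0.
  move=> /J_nil H; apply: contrapT => /eqP c0; apply: (e_neq0 (i := i)).
  have eX k : (lfun_exp (c *: e i) k \o e i = c ^+ k *: e i)%VF.
    elim: k => [|k IH]; first by rewrite comp_lfun1l expr0 scale1r.
    rewrite lfun_expS -comp_lfunA IH -comp_lfunZl -comp_lfunZr e_orth eqxx scale1r.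
    by rewrite scalerA exprS.
  have := eX m; rewrite H comp_lfun0l => /esym/eqP.
  by rewrite scaler_eq0 expf_eq0 (negbTE c0) andbF /= => /eqP.
have eA i a c : J (a - \sum_i c i *: e i) -> J ((e i \o a)%VF - c i *: e i).
  move=> Ja; have -> : c i *: e i = (e i \o \sum_i c i *: e i)%VF.
    rewrite comp_lfun_sumr (bigD1 i) //= -comp_lfunZr e_orth eqxx scale1r big1 ?addr0 //.
    by move=> j ji; rewrite -comp_lfunZr e_orth eq_sym (negbTE ji) scale0r scaler0.
  by rewrite -comp_lfunNr -comp_lfunDr; apply: JM.
(* The left ideals M i are maximal, and their intersection is J. *)
pose M i : set 'End(V) := [set a | A a /\ J (e i \o a)%VF].
have M_max i : maximal_left_ideal A (M i).
  have ML : left_ideal A (M i).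
    split=> [a []//||a b [Aa Ja] [Ab Jb]|b a Ab [Aa Ja]].
    - by split; [apply: subalg0 | rewrite comp_lfun0r].
    - split; first exact: subalgB.
      by rewrite comp_lfunDr comp_lfunNr; apply: JB.
    - split; first exact: subalgM.
      have [c /(eA i)] := e_span Ab.
      move=> /J_mulr /(_ Aa) H; rewrite comp_lfunA -[X in J X](subrK (c i *: e i \o a)%VF).
      apply: JD; first by rewrite -comp_lfunNl -comp_lfunDl.
      by rewrite -comp_lfunZl; apply: JZ.
  split=> // [MA|L [LA L0 LB LM] sML LnM].
    have : M i \1%VF by rewrite MA; apply: subalg1.
    case=> _; rewrite comp_lfun1r -[e i]scale1r => /eJ /eqP.
    by rewrite oner_eq0.
  apply: contrapT => LM'; apply: LnM; rewrite eqEsubset; split=> // b Ab.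
  have [a [La nMa]] : exists a, L a /\ ~ M i a.
    apply: contrapT => H; apply: LM'; rewrite eqEsubset; split=> // a La.
    by apply: contrapT => nMa; apply: H; exists a.
  have Aa := LA _ La; have [c /(eA i) Jc] := e_span Aa.
  have ci0 : c i != 0.
    apply/eqP => ci; apply: nMa; split=> //.
    by move: Jc; rewrite ci scale0r subr0.
  have LJ x : J x -> L x by move=> Jx; apply: sML; split; [apply: JA|apply: JM].
  (* Modulo J, e_i a is a nonzero multiple of e_i, and J is contained in L. Once e_i is in L, so is
     all of A, because 1 - e_i lies in [M i]. *)
  have Le : L (e i).
    have -> : e i = ((c i)^-1 *: \1 \o
       ((e i \o a) - ((e i \o a) - c i *: e i)))%VF.
      by rewrite opprB addrC subrK -comp_lfunZl comp_lfun1l scalerA mulVf ?scale1r.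
    apply: (LM); first by apply: subalgZ (subalg1 _).
    by apply: LB; [apply: LM | apply: LJ].
  have Me : M i (\1%VF - e i).
    split; first by apply: subalgB => //; apply: subalg1.
    by rewrite comp_lfunDr comp_lfunNr comp_lfun1r e_orth eqxx scale1r subrr.
  have -> : b = ((b \o (\1 - e i)) - ((- b) \o e i))%VF.
    by rewrite comp_lfunNl opprK -comp_lfunDr subrK comp_lfun1r.
  apply: (LB); first by apply: (LM) => //; apply: sML.
  by apply: LM => //; rewrite -scaleN1r; apply: subalgZ.
move=> a [Aa Ma]; have [c Jc] := e_span Aa.
have c0 i : c i = 0.
  apply: (eJ i); have [_ Ji] := Ma _ (M_max i).
  have := JB _ _ Ji (eA i _ _ Jc); by rewrite opprB addrC subrK.
by move: Jc; under eq_bigr do rewrite c0 scale0r; rewrite big1_eq subr0.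
Qed.

Lemma Jac_nil_ideal : J = Jac A.
Proof. by rewrite eqEsubset; split; [apply: nil_ideal_sub_Jac|apply: Jac_sub_nil_ideal]. Qed.

End Jacobson.

(** * Spectral projections of an operator P with P^N = 1 *)

Lemma sum_shift (W : zmodType) (F : nat -> W) N :
  F N = F 0%N -> \sum_(k < N) F k.+1 = \sum_(k < N) F k.
Proof.
case: N => [|N] FN; first by rewrite !big_ord0.
by rewrite big_ord_recr [RHS]big_ord_recl addrC /= FN.
Qed.

Section RootOfUnity.
Variables (P : 'End(V)) (N : nat) (z : K).
Hypotheses (z_prim : N.-primitive_root z) (PN : lfun_exp P N = \1%VF).

(** The discrete Fourier transform of the powers of P: the projection onto the eigenspace of P for
    z^i. *)
Definition eigenproj (i : 'I_N) : 'End(V) :=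
  N%:R^-1 *: \sum_(k < N) z ^- (i * k) *: lfun_exp P k.

Let N_gt0 : (0 < N)%N := prim_order_gt0 z_prim.
Let N_neq0 : N%:R != 0 :> K := prim_root_natf_neq0 z_prim.
Let z_neq0 : z != 0. Proof. by rewrite (prim_root_eq0 z_prim) -lt0n. Qed.

Lemma sum_prim_root (k : nat) :
  \sum_(i < N) z ^- (i * k) = (N %| k)%:R * N%:R :> K.
Proof.
under eq_bigr do rewrite mulnC exprM -exprVn.
rewrite (prim_order_dvd z_prim); have [zk|zk] := eqVneq.
  by under eq_bigr do rewrite zk invr1 expr1n; rewrite sumr_const card_ord mul1r.
rewrite mul0r; apply/eqP.
have /eqP := subrX1 (z ^+ k)^-1 N.
rewrite exprVn -exprM mulnC exprM (prim_expr_order z_prim) expr1n invr1 subrr eq_sym mulf_eq0.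
by rewrite subr_eq0 invr_eq1 (negbTE zk).
Qed.

Lemma eigenprojP (i : 'I_N) : (P \o eigenproj i)%VF = z ^+ i *: eigenproj i.
Proof.
rewrite /eigenproj -comp_lfunZr scalerA mulrC -scalerA; congr (_ *: _).
rewrite comp_lfun_sumr scaler_sumr.
pose F k := z ^+ i *: (z ^- (i * k) *: lfun_exp P k).
transitivity (\sum_(k < N) F k.+1).
  apply: eq_bigr => k _; rewrite /F -comp_lfunZr scalerA; congr (_ *: _).
  by rewrite mulnS exprD invfM mulrA divff ?mul1r // expf_neq0.
rewrite sum_shift // /F PN muln0 mulnC exprM (prim_expr_order z_prim) expr1n.
by rewrite expr0.
Qed.

Lemma eigenproj_eigen (i j : 'I_N) v :
  P v = z ^+ j *: v -> eigenproj i v = (i == j)%:R *: v.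
Proof.
move=> Pv; have PX k : lfun_exp P k v = z ^+ (j * k) *: v.
  elim: k => [|k IH]; first by rewrite muln0 expr0 scale1r id_lfunE.
  by rewrite lfun_expS comp_lfunE IH linearZ /= Pv scalerA -exprD mulnS addnC.
rewrite /eigenproj scale_lfunE sum_lfunE.
under eq_bigr => k _ do rewrite scale_lfunE PX scalerA.
rewrite -scaler_suml scalerA; congr (_ *: _).
(* A natural number congruent to i - j modulo N. *)
pose d := (i + (N - j))%N.
have -> : \sum_(k < N) z ^- (i * k) * z ^+ (j * k) = \sum_(k < N) z ^- (k * d).
  apply: eq_bigr => k _; rewrite mulnC [(j * k)%N]mulnC mulnDr exprD invfM; congr (_ * _).
  apply: (mulIf (expf_neq0 (k * (N - j)) z_neq0)); rewrite mulVf ?expf_neq0 //.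
  rewrite -exprD -mulnDr subnKC ?(ltnW (ltn_ord j)) // mulnC exprM.
  by rewrite (prim_expr_order z_prim) expr1n.
rewrite sum_prim_root mulrCA mulVf // mulr1; congr (_ %:R).
have -> : (N %| d)%N = (i == j %[mod N])%N.
  rewrite -(eqn_modDr (N - j)) subnKC ?(ltnW (ltn_ord j)) // modnn.
  by rewrite /dvdn.
by rewrite !modn_small.
Qed.

Lemma eigenproj_orth (i j : 'I_N) :
  (eigenproj i \o eigenproj j)%VF = (i == j)%:R *: eigenproj j.
Proof.
apply/lfunP => v; rewrite comp_lfunE [RHS]scale_lfunE; apply: eigenproj_eigen.
by rewrite -comp_lfunE eigenprojP [LHS]scale_lfunE.
Qed.

Lemma sum_eigenproj : \sum_i eigenproj i = \1%VF.
Proof.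
rewrite -scaler_sumr exchange_big /=.
under eq_bigr do rewrite -scaler_suml sum_prim_root.
rewrite (bigD1 (Ordinal N_gt0)) //= dvdn0 mul1r big1 => [|k k0].
  by rewrite addr0 scalerA mulVf ?scale1r.
by rewrite gtnNdvd ?mul0r ?scale0r // lt0n.
Qed.

Lemma eigenproj_subalg A i : unital_subalgebra A -> A P -> A (eigenproj i).
Proof.
move=> A_alg AP; apply: subalgZ => //; apply: subalg_sum => // k.
by apply: subalgZ => //; apply: subalgX.
Qed.

Lemma eigenproj_sumM (c : 'I_N -> K) i :
  ((\sum_j c j *: eigenproj j) \o eigenproj i = c i *: eigenproj i)%VF.
Proof.
rewrite comp_lfun_suml (bigD1 i) //= big1 => [|j ji].
  by rewrite addr0 -comp_lfunZl eigenproj_orth eqxx scale1r.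
by rewrite -comp_lfunZl eigenproj_orth (negbTE ji) scale0r scaler0.
Qed.

Lemma eigenproj_sumMr (c : 'I_N -> K) i :
  (eigenproj i \o (\sum_j c j *: eigenproj j) = c i *: eigenproj i)%VF.
Proof.
rewrite comp_lfun_sumr (bigD1 i) //= big1 => [|j ji].
  by rewrite addr0 -comp_lfunZr eigenproj_orth eqxx scale1r.
by rewrite -comp_lfunZr eigenproj_orth eq_sym (negbTE ji) scale0r scaler0.
Qed.

Definition eigenproj_span : set 'End(V) :=
  [set a | exists c : 'I_N -> K, a = \sum_i c i *: eigenproj i].

Lemma eigenproj_span_subalg : unital_subalgebra eigenproj_span.
Proof.
split=> [|k _ _ [c ->] [d ->]|_ _ [c ->] [d ->]].
- by exists (fun=> 1); under eq_bigr do rewrite scale1r; rewrite sum_eigenproj.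
- exists (fun i => k * c i + d i); rewrite scaler_sumr -big_split /=.
  by apply: eq_bigr => i _; rewrite scalerDl scalerA.
- exists (fun i => c i * d i); rewrite comp_lfun_sumr.
  by apply: eq_bigr => i _; rewrite -comp_lfunZr eigenproj_sumM scalerA mulrC.
Qed.

Lemma eigenproj_span_gen : eigenproj_span P.
Proof.
exists (fun i => z ^+ i); rewrite -{1}[P]comp_lfun1r -sum_eigenproj comp_lfun_sumr.
by apply: eq_bigr => i _; rewrite eigenprojP.
Qed.

(** The projections form a basis of the algebra consisting of orthogonal idempotents, so the lines
    they span are minimal left ideals and the algebra is their direct sum. *)
Lemma semisimple_root_of_unity : (forall i, eigenproj i <> 0) ->
  semisimple_algebra (generated_algebra [set P; (P^-1)%VF]).
Proof.
move=> e_neq0; set A := generated_algebra _.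
have A_alg : unital_subalgebra A := generated_subalgebra _.
have AP : A P by apply: sub_generated; left.
have Ae i : A (eigenproj i) := eigenproj_subalg i A_alg AP.
have A_span a : A a -> eigenproj_span a.
  apply; first exact: eigenproj_span_subalg.
  move=> b [] ->; first exact: eigenproj_span_gen.
  rewrite (@lfun_exp_inv P N.-1); last by rewrite prednK.
  by apply: subalgX; [apply: eigenproj_span_subalg|apply: eigenproj_span_gen].
pose I (i : 'I_N) : set 'End(V) := [set a | exists c : K, a = c *: eigenproj i].
exists N, I; split=> [i|a Aa].
  split=> [|I0|L [LA L0 LB LM] LI Ln0].
  - split=> [_ [c ->]||_ _ [c ->] [d ->]|a _ /A_span[d ->] [c ->]].
    + exact: (subalgZ A_alg c (Ae i)).
    + by exists 0; rewrite scale0r.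
    + by exists (c - d); rewrite scalerBl.
    + by exists (c * d i); rewrite -comp_lfunZr eigenproj_sumM scalerA.
  - apply: (e_neq0 i); have : I i (eigenproj i) by exists 1; rewrite scale1r.
    by rewrite I0.
  - rewrite eqEsubset; split=> // _ [c ->].
    have [a [La a0]] : exists a, L a /\ a <> 0.
      apply: contrapT => H; apply: Ln0; rewrite eqEsubset; split=> [a La|_ -> //].
      by apply: contrapT => a0; apply: H; exists a.
    have [d ad] := LI _ La; have d0 : d != 0.
      by apply/eqP => d0; apply: a0; rewrite ad d0 scale0r.
    have -> : c *: eigenproj i = ((c / d) *: \1 \o a)%VF.
      by rewrite ad -comp_lfunZl comp_lfun1l [RHS]scalerA divfK.
    by apply: LM => //; apply: (subalgZ A_alg); apply: (subalg1 A_alg).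
have [c ac] := A_span a Aa.
exists [ffun i => c i *: eigenproj i]; split.
  split=> [i|]; first by rewrite ffunE; exists (c i).
  by rewrite ac; apply: eq_bigr => i _; rewrite ffunE.
move=> x [Ix ax]; apply/ffunP => i; rewrite ffunE -eigenproj_sumMr -ac ax.
rewrite comp_lfun_sumr (bigD1 i) //= big1 => [|j ji].
  by have [d ->] := Ix i; rewrite addr0 -comp_lfunZr eigenproj_orth eqxx scale1r.
by have [d ->] := Ix j; rewrite -comp_lfunZr eigenproj_orth eq_sym (negbTE ji) scale0r scaler0.
Qed.

End RootOfUnity.
End Operators.

(** * Subalgebras modulo an ideal, and inverse operators *)

Section IdealAlgebra.
Variables (K : fieldType) (V : vectType K).
Variables (A J B : set 'End(V)).
Hypotheses (A_alg : unital_subalgebra A) (J_ideal : left_ideal A J).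
Hypothesis J_mulr : forall a b, J a -> A b -> J (a \o b)%VF.
Hypotheses (B_alg : unital_subalgebra B) (BA : B `<=` A).

(** Serves to prove A = B + J by checking it on generators only. *)
Lemma subalg_add_ideal :
  unital_subalgebra [set a | A a /\ exists2 p, B p & J (a - p)].
Proof.
case: J_ideal => JA J0 JB JM.
have JD := left_idealD J_ideal.
split=> [|c a b [Aa [p Bp Jp]] [Ab [q Bq Jq]]|a b [Aa [p Bp Jp]] [Ab [q Bq Jq]]].
- split; first exact: subalg1.
  by exists \1%VF; [exact: subalg1 | rewrite subrr].
- split; first by apply: (subalgD A_alg) => //; apply: subalgZ.
  exists (c *: p + q); first by apply: (subalgD B_alg) => //; apply: subalgZ.
  rewrite opprD addrACA -scalerBr; apply: JD => //.
  rewrite -[a - p]comp_lfun1l comp_lfunZl; apply: JM => //.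
  by apply: subalgZ (subalg1 _).
- split; first exact: subalgM.
  exists (p \o q)%VF; first exact: subalgM.
  have -> : ((a \o b) - (p \o q) = ((a - p) \o b) + (p \o (b - q)))%VF.
    by rewrite comp_lfunDl comp_lfunNl comp_lfunDr comp_lfunNr addrA subrK.
  by apply: JD; [apply: J_mulr | apply: JM => //; apply: BA].
Qed.

End IdealAlgebra.

Section InverseOperators.
Variables (K : fieldType) (E : vectType K) (f g : 'End(E)).

Lemma CopE v : Cop f v = f v + (f^-1)%VF v.
Proof. by rewrite add_lfunE. Qed.

Lemma DopE v : Dop f g v = g (f v - (f^-1)%VF v).
Proof. by rewrite comp_lfunE add_lfunE opp_lfunE. Qed.

Lemma lfun_expVK k v : lker f == 0%VS -> lfun_exp (f^-1)%VF k (lfun_exp f k v) = v.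
Proof.
move=> fI; elim: k => [|k IH]; first by rewrite !id_lfunE.
by rewrite lfun_expSr lfun_expS !comp_lfunE lker0_lfunK.
Qed.

End InverseOperators.

(** * Chebyshev polynomials and interpolation *)

Section ChebyshevStep.
Variables (F : numFieldType) (q : F).

(** The recursion is multiplication of (p + y q) / 2 by a x + b y, where a, b = (q +- q^-1) / 2 for
    the parameter [q], reduced with y^2 = x^2 - 4. *)
Fixpoint cheb (k : nat) : {poly F} * {poly F} :=
  if k is k'.+1 then
    (((q + q^-1) / 2) *: ('X * (cheb k').1)
       + ((q - q^-1) / 2) *: ('X * ('X * (cheb k').2) - 4 *: (cheb k').2),
     ((q + q^-1) / 2) *: ('X * (cheb k').2) + ((q - q^-1) / 2) *: (cheb k').1)
  else (2%:P, 0).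

Lemma cheb_horner (x y : F) (k : nat) : y ^+ 2 = x ^+ 2 - 4 ->
  let xp := (q + q^-1) / 2 * x + (q - q^-1) / 2 * y in
  let xm := (q + q^-1) / 2 * x - (q - q^-1) / 2 * y in
  (cheb k).1.[x] = xp ^+ k + xm ^+ k /\ y * (cheb k).2.[x] = xp ^+ k - xm ^+ k.
Proof.
move=> hy /=; set a := _ / 2; set b := _ / 2.
elim: k => [|k [IH1 IH2]]; first by rewrite /= hornerC horner0 mulr0 !expr0 subrr.
rewrite /= -/a -/b !(hornerD, hornerN, hornerZ, hornerM, hornerX) !exprS.
split; last first.
  transitivity (a * x * (y * (cheb k).2.[x]) + b * y * (cheb k).1.[x]); first by ring.
  by rewrite IH1 IH2; ring.
transitivity (a * x * (cheb k).1.[x] + b * y * (y * (cheb k).2.[x])).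
  have -> : b * y * (y * (cheb k).2.[x]) = b * (y ^+ 2 * (cheb k).2.[x]) by ring.
  by rewrite hy; ring.
by rewrite IH1 IH2; ring.
Qed.

Lemma size_cheb k : (size (cheb k).1 <= k.+1)%N /\ (size (cheb k).2 <= k)%N.
Proof.
elim: k => [|k [IH1 IH2]]; first by rewrite size_polyC size_poly0; case: eqP.
have sX (p : {poly F}) m : (size p <= m)%N -> (size ('X * p)%R <= m.+1)%N.
  by move=> pm; apply: leq_trans (size_polyMleq _ _) _; rewrite size_polyX.
have sZ (p : {poly F}) c m : (size p <= m)%N -> (size (c *: p) <= m)%N.
  by apply: leq_trans; apply: size_scale_leq.
have sD (p r : {poly F}) m : (size p <= m -> size r <= m -> size (p + r)%R <= m)%N.
  by move=> pm rm; rewrite (leq_trans (size_polyD _ _)) // geq_max pm rm.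
split=> /=; apply: (sD); rewrite ?sX ?sZ //.
- by rewrite sX.
- apply: sD; first by rewrite !sX.
  by rewrite size_polyN sZ // (leq_trans IH2) // -addn2 leq_addr.
- by rewrite sX.
Qed.

(** The leading coefficients obey a linear recursion with matrix [[a, b], [b, a]], whose eigenvalues
    a + b and a - b are q and q^-1. The factor ['X] in the second component keeps the degrees equal
    and covers k = 0. *)
Lemma cheb_lead k : (cheb k).1`_k = q ^+ k + q ^- k /\
  ('X * (cheb k).2)`_k = q ^+ k - q ^- k.
Proof.
elim: k => [|k [IH1 IH2]].
  by rewrite /= mulr0 coefC coef0 /= !expr0 invr1 subrr; split=> //; ring.
have [_ s2] := size_cheb k.
have cX (p : {poly F}) m : ('X * p)`_m.+1 = p`_m by rewrite coefXM.
rewrite [(cheb k.+1).1]/= [(cheb k.+1).2]/= cX !(coefD, coefZ, coefN) !cX IH1 IH2.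
rewrite nth_default; last exact: leq_trans s2 (leqnSn k).
by rewrite -!exprVn !exprS; move: q^-1 => r; split; field.
Qed.

End ChebyshevStep.

(** Newton interpolation: each new node is corrected by a multiple of the polynomial vanishing at
    the earlier ones. *)
Lemma interpolation (F : fieldType) (I : eqType) (s : seq I) (x v : I -> F) :
  uniq s -> {in s &, injective x} ->
  exists2 p : {poly F}, (size p <= size s)%N & {in s, forall i, p.[x i] = v i}.
Proof.
elim: s => [|i s IH] /=; first by exists 0; rewrite ?size_poly0.
case/andP=> is_ us xI; have [|p sp hp] := IH us.
  by move=> j k js ks; apply: xI; rewrite inE ?js ?ks orbT.
pose r := \prod_(a <- map x s) ('X - a%:P).
have ri : r.[x i] != 0.
  rewrite -/(root _ _) root_prod_XsubC; apply/mapP=> [[j js xij]].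
  by move: is_; rewrite (xI _ _ _ _ xij) ?js ?inE ?eqxx ?js ?orbT.
exists (p + ((v i - p.[x i]) / r.[x i]) *: r).
  rewrite (leq_trans (size_polyD _ _)) // geq_max (leq_trans sp) //=.
  by rewrite (leq_trans (size_scale_leq _ _)) // size_prod_XsubC size_map.
move=> j; rewrite inE => /predU1P[->|js]; rewrite hornerD hornerZ.
  by rewrite divfK // addrC subrK.
have -> : r.[x j] = 0.
  by apply/rootP; rewrite root_prod_XsubC; apply: map_f.
by rewrite mulr0 addr0 hp.
Qed.

(** * The cyclic model *)

Section CyclicOperators.
Variables (R : realType) (N n : nat) (u : R[i]).
Hypotheses (hNn : N = (2 * n)%N) (hN4 : (4 <= N)%N).
Hypotheses (hu : u != 0) (huN : u ^+ N != 1).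
Local Notation C := R[i].
Local Notation w := (omega R N).

Let N_gt0 : (0 < N)%N. Proof. exact: leq_trans hN4. Qed.
Let n_gt1 : (1 < n)%N. Proof. by move: hN4; rewrite hNn mul2n -(leq_double 2). Qed.

Lemma omegaX (k : nat) :
  w ^+ k = (cos (2 * pi / N%:R * k%:R) +i* sin (2 * pi / N%:R * k%:R))%C.
Proof.
elim: k => [|k IH]; first by rewrite mulr0 cos0 sin0.
rewrite exprS IH /omega; set a := 2 * pi / N%:R.
have -> : a * k.+1%:R = a + a * k%:R by rewrite mulrS mulrDr mulr1.
by rewrite cosD sinD; apply/eqP; rewrite eq_complex /= eqxx /= addrC eqxx.
Qed.

(** If the order m were a proper divisor of N, then cos(2 pi m / N) = 1 would give sin(pi m / N) =
    0, although this angle lies strictly between 0 and pi. *)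
Lemma omega_prim : N.-primitive_root w.
Proof.
have N0 : N%:R != 0 :> R by rewrite pnatr_eq0 -lt0n.
have wN : w ^+ N = 1.
  by rewrite omegaX divfK // mulrC mulr_natr cos2pi sin2pi.
have [m m_prim mN] := prim_order_exists N_gt0 wN.
have m_gt0 := prim_order_gt0 m_prim.
have [mN'|Nm] := ltnP m N; last first.
  suff e : N = m by rewrite [X in X.-primitive_root _]e.
  by apply/eqP; rewrite eqn_leq Nm dvdn_leq.
have /eqP := prim_expr_order m_prim; rewrite omegaX eq_complex /= => /andP[/eqP + _].
set x : R := pi / N%:R * m%:R.
have -> : 2 * pi / N%:R * m%:R = x *+ 2 by rewrite /x; field.
have x_gt0 : 0 < sin x.
  apply: sin_gt0_pi; rewrite mulr_gt0 ?divr_gt0 ?pi_gt0 ?ltr0n //=.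
  by rewrite /x mulrAC ltr_pdivrMr ?ltr0n // ltr_pM2l ?pi_gt0 // ltr_nat.
rewrite cos_mulr2n cos2sin2 => h.
have : sin x ^+ 2 = 0 by lra.
by move/eqP; rewrite expf_eq0 /= gt_eqF.
Qed.

Lemma omega_neq0 : w != 0.
Proof. by rewrite (prim_root_eq0 omega_prim) -lt0n. Qed.

Lemma omega_half : w ^+ n = -1.
Proof.
have : (w ^+ n) ^+ 2 == 1 by rewrite -exprM mulnC -hNn (prim_expr_order omega_prim).
rewrite sqrf_eq1 => /orP[|/eqP //]; rewrite -(prim_order_dvd omega_prim).
have n_gt0 := ltnW n_gt1.
by rewrite gtnNdvd // hNn -[ltnLHS]mul1n ltn_pmul2r.
Qed.

Lemma omega_ordS (j : 'I_N) : w ^+ ordS j = w * w ^+ j.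
Proof. by rewrite /= (prim_expr_mod omega_prim) exprS. Qed.

Lemma omega_ord_pred (j : 'I_N) : w ^+ ord_pred j = w^-1 * w ^+ j.
Proof.
by rewrite -[in RHS](ord_predK j) omega_ordS mulKf ?omega_neq0.
Qed.

Lemma t_opE v i : t_op R N v i 0 = v (ordS i) 0.
Proof.
rewrite lfunE /= mxE (bigD1 (ordS i)) //= mxE ordSK eqxx mul1r big1 ?addr0 // => j ji.
rewrite mxE; case: eqP => [ij|]; last by rewrite mul0r.
by rewrite ij ord_predK eqxx in ji.
Qed.

Let t_inv (v : 'cV[C]_N) : 'cV[C]_N := \col_i v (ord_pred i) 0.

Let t_opK : cancel (t_op R N) t_inv.
Proof. by move=> v; apply/colP => i; rewrite mxE t_opE ord_predK. Qed.

Let t_invK : cancel t_inv (t_op R N).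
Proof. by move=> v; apply/colP => i; rewrite t_opE mxE ordSK. Qed.

Lemma t_op_invE v i : ((t_op R N)^-1)%VF v i 0 = v (ord_pred i) 0.
Proof. by rewrite (lfun_invE t_opK t_invK) mxE. Qed.

Lemma t_op_bij : bijective (t_op R N).
Proof. by exists t_inv. Qed.

Lemma t_op_order : lfun_exp (t_op R N) N = \1%VF.
Proof.
have E k v i : iter k (t_op R N) v i 0 = v (iter k (@ordS N) i) 0.
  by elim: k v i => //= k IH v i; rewrite t_opE IH -iterS iterSr.
apply/lfunP => v; apply/colP => i; rewrite lfun_expE E id_lfunE; congr (v _ _).
have F k : iter k (@ordS N) i = ((i + k) %% N)%N :> nat.
  elim: k => [|k IH]; first by rewrite addn0 modn_small.
  by rewrite iterS /= IH -addn1 modnDml addn1 addnS.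
by apply: val_inj; rewrite /= F modnDr modn_small.
Qed.

Let d_opE v i : d_op R N v i 0 = w ^+ i * v i 0.
Proof.
by rewrite lfunE /= mul_diag_mx !mxE.
Qed.

Let d_op_invE v i : ((d_op R N)^-1)%VF v i 0 = w ^- i * v i 0.
Proof.
pose g (v : 'cV[C]_N) : 'cV[C]_N := \col_i (w ^- i * v i 0).
rewrite (@lfun_invE _ _ _ g) ?mxE // => x; apply/colP => j.
  by rewrite mxE d_opE mulKf // expf_neq0 ?omega_neq0.
by rewrite d_opE mxE mulVKf // expf_neq0 ?omega_neq0.
Qed.

Definition xval (k : nat) : C := u * w ^+ k + u^-1 * w ^- k.
Definition yval (k : nat) : C := u * w ^+ k - u^-1 * w ^- k.

(** Since N = 2n is even, (u w^k)^2 = 1 would give u^N = (u w^k)^N = 1. *)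
Lemma uomega_sqr_neq1 (k : nat) : (u * w ^+ k) ^+ 2 != 1.
Proof.
apply: contra huN => /eqP h.
have <- : (u * w ^+ k) ^+ N = u ^+ N.
  by rewrite exprMn -exprM mulnC exprM (prim_expr_order omega_prim) expr1n mulr1.
by apply/eqP; transitivity ((u * w ^+ k) ^+ (2 * n)); rewrite -?hNn // hNn exprM -hNn h expr1n.
Qed.

Lemma yval_neq0 (k : nat) : yval k != 0.
Proof.
apply: contra (uomega_sqr_neq1 k); rewrite subr_eq0 => /eqP h.
by rewrite expr2 {2}h mulrACA divff // mul1r divff // expf_neq0 // omega_neq0.
Qed.

Lemma s_opE v i : s_op N u v i 0 = (yval i)^-1 * v i 0.
Proof.
have E x j : (u *: d_op R N - u^-1 *: ((d_op R N)^-1)%VF) x j 0 = yval j * x j 0.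
  rewrite add_lfunE opp_lfunE !scale_lfunE 2!mxE d_opE mxE mxE d_op_invE.
  by rewrite /yval mulrBl !mulrA.
pose g (v : 'cV[C]_N) : 'cV[C]_N := \col_i ((yval i)^-1 * v i 0).
rewrite (@lfun_invE _ _ _ g) ?mxE // => x; apply/colP => j.
  by rewrite mxE E mulKf // yval_neq0.
by rewrite E mxE mulVKf // yval_neq0.
Qed.

Lemma s_op_bij : bijective (s_op N u).
Proof.
exists (fun v : 'cV[C]_N => \col_i (yval i * v i 0) : 'cV[C]_N) => x; apply/colP => j.
  by rewrite mxE s_opE mulVKf // yval_neq0.
by rewrite s_opE mxE mulKf // yval_neq0.
Qed.

(** * The cyclic ring and its evaluation at the N-th roots of unity *)

Local Notation modulus := ('X^N - 1 : {poly C}).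

Lemma mk_monic_Xn_sub_1 : mk_monic modulus = modulus.
Proof.
rewrite /mk_monic size_Xn_sub_1 // monic_Xn_sub_1 // andbT.
by rewrite ltnS N_gt0.
Qed.

Lemma horner_in_qpoly (p : {poly C}) (j : nat) :
  (in_qpoly modulus p : {poly C}).[w ^+ j] = p.[w ^+ j].
Proof.
have mon : modulus \is monic by rewrite monic_Xn_sub_1.
rewrite [RHS](congr1 (fun q => q.[w ^+ j]) (Pdiv.RingMonic.rdivp_eq mon p)).
rewrite hornerD hornerM [modulus.[_]]hornerD hornerN hornerC hornerXn.
rewrite -exprM mulnC exprM (prim_expr_order omega_prim) expr1n subrr mulr0 add0r.
by rewrite /in_qpoly /= mk_monic_Xn_sub_1.
Qed.

Local Notation cyclic_ring := {poly %/ modulus}.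

Lemma evM (f g : cyclic_ring) i : ev (f * g) i 0 = ev f i 0 * ev g i 0.
Proof. rewrite !mxE -hornerM -[RHS]horner_in_qpoly; congr (_.[_]); exact: poly_of_qpolyM. Qed.

Lemma ev1 i : ev (1 : cyclic_ring) i 0 = 1.
Proof. by rewrite mxE hornerC. Qed.

Lemma evXn (f : cyclic_ring) r i : ev (f ^+ r) i 0 = ev f i 0 ^+ r.
Proof. by elim: r => [|r IH]; rewrite ?ev1 // !exprS evM IH. Qed.

Lemma ev_qX i : ev (qpolyX modulus) i 0 = w ^+ i.
Proof. by rewrite mxE horner_in_qpoly hornerX. Qed.

Lemma ev_qXV i : ev ((qpolyX modulus)^-1) i 0 = w ^- i.
Proof.
have h0 : in_qpoly modulus modulus = 0.
  apply: val_inj; rewrite /= mk_monic_Xn_sub_1.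
  by rewrite Pdiv.RingMonic.rmodpp // monic_Xn_sub_1.
have qN : qpolyX modulus ^+ N = 1.
  have : in_qpoly modulus ('X ^+ N) = 1.
    by have := in_qpolyD modulus modulus 1; rewrite subrK h0 add0r in_qpoly1.
  by rewrite rmorphXn.
have q_unit : qpolyX modulus \is a GRing.unit.
  by rewrite -(unitrX_pos _ N_gt0) qN unitr1.
have := evM (qpolyX modulus) (qpolyX modulus)^-1 i.
rewrite divrr // ev1 ev_qX => h.
by apply: (mulfI (expf_neq0 i omega_neq0)); rewrite -h divff // expf_neq0 ?omega_neq0.
Qed.

Lemma ev_x_elt i : ev (x_elt N u) i 0 = xval i.
Proof.
have := ev_qX i; have := ev_qXV i; rewrite !mxE => hV hX.
by rewrite hornerD !hornerZ hV hX.
Qed.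

Lemma ev_rho_elt i : ev (rho_elt R N n) i 0 = (-1) ^+ i.
Proof. by rewrite evXn ev_qX -exprM mulnC exprM omega_half. Qed.

Lemma sign_ordS (i : 'I_N) : (-1) ^+ ordS i = - (-1) ^+ i :> C.
Proof.
by rewrite -[in LHS]omega_half -exprM mulnC exprM omega_ordS exprMn omega_half
   -exprM mulnC exprM omega_half mulN1r.
Qed.

Lemma sign_ord_pred (i : 'I_N) : (-1) ^+ ord_pred i = - (-1) ^+ i :> C.
Proof. by rewrite -[in RHS](ord_predK i) sign_ordS opprK. Qed.

Lemma xval_ordS (j : 'I_N) :
  xval (ordS j) = (w + w^-1) / 2 * xval j + (w - w^-1) / 2 * yval j.
Proof. by rewrite /xval /yval omega_ordS; field; rewrite hu ?expf_neq0 ?omega_neq0. Qed.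

Lemma xval_ord_pred (j : 'I_N) :
  xval (ord_pred j) = (w + w^-1) / 2 * xval j - (w - w^-1) / 2 * yval j.
Proof. by rewrite /xval /yval omega_ord_pred; field; rewrite hu ?expf_neq0 ?omega_neq0. Qed.

Lemma yval_sqr k : yval k ^+ 2 = xval k ^+ 2 - 4.
Proof. by rewrite /yval /xval; field; rewrite hu expf_neq0 // omega_neq0. Qed.

(** The difference x_i - x_j is, up to a nonzero factor, (w^i - w^j)(u^2 w^(i+j) - 1). For i + j
    even the second factor is (u w^k)^2 - 1 with k = (i+j)/2, hence nonzero. *)
Lemma xval_inj (i j : nat) : (i < N)%N -> (j < N)%N -> odd i = odd j ->
  xval i = xval j -> i = j.
Proof.
move=> iN jN oij h.
have : (w ^+ i - w ^+ j) * ((u ^+ 2 * w ^+ i * w ^+ j) - 1) = 0.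
  have ui : w ^+ i != 0 by rewrite expf_neq0 // omega_neq0.
  have uj : w ^+ j != 0 by rewrite expf_neq0 // omega_neq0.
  transitivity (u * w ^+ i * w ^+ j * (xval i - xval j)); last by rewrite h subrr mulr0.
  by rewrite /xval; field; rewrite hu ui uj.
move=> /eqP; rewrite mulf_eq0 => /orP[|].
  by rewrite subr_eq0 (eq_prim_root_expr omega_prim) !modn_small // => /eqP.
rewrite subr_eq0 -mulrA -exprD; have -> : (i + j = ((i + j)./2 * 2))%N.
  by rewrite muln2 -[LHS]odd_double_half oddD oij addbb.
by rewrite exprM -exprMn (negbTE (uomega_sqr_neq1 _)).
Qed.

(** * The operators C and D on the spaces K_m *)

Definition kcol (b : bool) (p : {poly C}) : 'cV[C]_N :=
  \col_j (((-1) ^+ b) ^+ j * p.[xval j]).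

Local Notation t := (t_op R N).
Local Notation s := (s_op N u).
Local Notation Kf := (K_space N u n).

Lemma kcolD b p q : kcol b (p + q) = kcol b p + kcol b q.
Proof. by apply/colP => i; rewrite !mxE hornerD mulrDr. Qed.

Lemma kcolZ b c p : kcol b (c *: p) = c *: kcol b p.
Proof. by apply/colP => i; rewrite !mxE hornerZ mulrCA. Qed.

(** [kcol b p] is the vector of values of rho^b p(x), because rho takes the value (-1)^j at w^j. *)
Lemma kcol_mono m b r : (r < m)%N -> kcol b 'X^r \in Kf m.
Proof.
move=> rm; apply: memv_span; rewrite mem_cat; apply/orP; case: b; [right|left];
  apply/mapP; exists r; rewrite ?mem_iota //; apply/colP => i.
  by rewrite evM evXn ev_x_elt ev_rho_elt mxE hornerXn.
by rewrite evXn ev_x_elt mxE hornerXn expr1n mul1r.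
Qed.

Lemma kcol_mem m b (p : {poly C}) : (size p <= m)%N -> kcol b p \in Kf m.
Proof.
move=> pm; have -> : kcol b p = \sum_(r < size p) p`_r *: kcol b 'X^r.
  apply/colP => i; rewrite mxE horner_coef summxE mulr_sumr.
  by apply: eq_bigr => r _; rewrite !mxE hornerXn mulrCA.
by apply: memv_suml => r _; apply: memvZ; apply: kcol_mono; apply: leq_trans pm.
Qed.

Lemma K_space_img m (f : 'End('cV[C]_N)) (U : {vspace 'cV[C]_N}) :
  (forall b r, (r < m)%N -> f (kcol b 'X^r) \in U) -> (f @: Kf m <= U)%VS.
Proof.
move=> fU; rewrite limg_span; apply/span_subvP => _ /mapP[v + ->].
rewrite mem_cat => /orP[]/mapP[r]; rewrite mem_iota => /= rm ->.
  suff -> : ev (x_elt N u ^+ r) = kcol false 'X^r by apply: fU.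
  by apply/colP => i; rewrite evXn ev_x_elt mxE hornerXn expr1n mul1r.
suff -> : ev (rho_elt R N n * x_elt N u ^+ r) = kcol true 'X^r by apply: fU.
by apply/colP => i; rewrite evM evXn ev_x_elt ev_rho_elt mxE hornerXn.
Qed.

Lemma bsign_ordS b (i : 'I_N) :
  ((-1) ^+ b) ^+ ordS i = (-1) ^+ b * ((-1) ^+ b) ^+ i :> C.
Proof. by rewrite -exprM mulnC exprM sign_ordS exprNn -exprM mulnC exprM. Qed.

Lemma bsign_ord_pred b (i : 'I_N) :
  ((-1) ^+ b) ^+ ord_pred i = (-1) ^+ b * ((-1) ^+ b) ^+ i :> C.
Proof. by rewrite -exprM mulnC exprM sign_ord_pred exprNn -exprM mulnC exprM. Qed.

Lemma Cop_kcol b r : Cop t (kcol b 'X^r) = (-1) ^+ b *: kcol b (cheb w r).1.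
Proof.
apply/colP => i; rewrite CopE mxE t_opE t_op_invE !mxE !hornerXn.
rewrite bsign_ordS bsign_ord_pred xval_ordS xval_ord_pred.
by have [-> _] := cheb_horner w r (yval_sqr i); rewrite -mulrDr mulrA.
Qed.

Lemma Dop_kcol b r : Dop t s (kcol b 'X^r) = (-1) ^+ b *: kcol b (cheb w r).2.
Proof.
apply/colP => i; rewrite DopE s_opE 2!mxE t_opE t_op_invE.
rewrite !mxE !hornerXn bsign_ordS bsign_ord_pred xval_ordS xval_ord_pred.
have [_ h] := cheb_horner w r (yval_sqr i); rewrite -mulrBr -h.
by apply: (mulfI (yval_neq0 i)); rewrite mulVKf ?yval_neq0 //; ring.
Qed.

Lemma Cop_K_space m : (Cop t @: Kf m <= Kf m)%VS.
Proof.
apply: K_space_img => b r rm; rewrite Cop_kcol; apply/memvZ/kcol_mem.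
by have [h _] := size_cheb w r; apply: leq_trans rm.
Qed.

Lemma Dop_K_space m : (Dop t s @: Kf m <= Kf m.-1)%VS.
Proof.
apply: K_space_img => b r rm; rewrite Dop_kcol; apply/memvZ/kcol_mem.
by have [_ h] := size_cheb w r; apply: (leq_trans h); case: m rm.
Qed.

Lemma K_space0 : Kf 0 = 0%VS.
Proof. by rewrite /K_space /= span_nil. Qed.

(** Let p and q, of degree below n, interpolate v on the even and on the odd indices. As (1 + rho)/2
    and (1 - rho)/2 are the indicators of these classes, v = (p + q)/2 + rho (p - q)/2. *)
Lemma K_space_full m : (n <= m)%N -> Kf m = fullv.
Proof.
move=> nm; apply/eqP; rewrite eqEsubv subvf /=; apply/subvP => v _.
(* Only indices below N occur, so the default of [insubd] is never met. *)
pose vn k := v (insubd (Ordinal N_gt0) k) 0.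
have interp (b : nat) : (b < 2)%N -> exists2 p : {poly C}, (size p <= n)%N &
    forall k, (k < n)%N -> p.[xval (b + k.*2)] = vn (b + k.*2)%N.
  move=> b2; have bN k : (k < n)%N -> (b + k.*2 < N)%N by lia.
  have [||p sp hp] := @interpolation C _ (iota 0 n) (fun k => xval (b + k.*2))
    (fun k => vn (b + k.*2)%N).
  - exact: iota_uniq.
  - move=> i j; rewrite !mem_iota /= !add0n => iN jN /xval_inj h.
    apply: double_inj; apply: (@addnI b); apply: h; rewrite ?bN //.
    by rewrite !oddD !odd_double.
  exists p => [|k kn]; first by rewrite size_iota in sp.
  by rewrite hp // mem_iota.
have [p sp hp] := interp 0%N isT; have [q sq hq] := interp 1%N isT.
have -> : v = kcol false (2^-1 *: (p + q)) + kcol true (2^-1 *: (p - q)).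
  apply/colP => i; rewrite !mxE !hornerZ !hornerD hornerN expr1n mul1r expr1.
  have iE := odd_double_half i.
  have kn : (i./2 < n)%N by have := ltn_ord i; lia.
  have vi : vn i = v i 0 by rewrite /vn; congr (v _ _); apply: val_inj; rewrite val_insubd ltn_ord.
  rewrite -signr_odd; move: iE; case: (odd i) => /= iE.
    by have := hq _ kn; rewrite iE vi => ->; rewrite expr1; field.
  by have := hp _ kn; rewrite iE vi => ->; rewrite expr0; field.
apply: memvD; apply: kcol_mem; apply: leq_trans (size_scale_leq _ _) (leq_trans _ nm).
  by rewrite (leq_trans (size_polyD _ _)) // geq_max sp sq.
by rewrite (leq_trans (size_polyD _ _)) // size_polyN geq_max sp sq.
Qed.

Lemma DopX_K_space r v : v \in Kf r -> lfun_exp (Dop t s) r v = 0.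
Proof.
elim: r v => [|r IH] v vK; first by move: vK; rewrite K_space0 memv0 => /eqP->; rewrite linear0.
rewrite lfun_expSr comp_lfunE; apply: IH.
by apply: (subvP (Dop_K_space r.+1)); apply: memv_img.
Qed.

(** By induction: D x^(r+1) is c x^r plus an element of K_r, and D^r kills K_r. *)
Lemma DopX_neq0 r : (r < n)%N -> lfun_exp (Dop t s) r (kcol false 'X^r) <> 0.
Proof.
elim: r => [_|r IH rn].
  rewrite id_lfunE => /colP/(_ (Ordinal N_gt0)).
  by rewrite !mxE hornerXn expr1n mul1r expr0 => /eqP; rewrite oner_eq0.
pose c := w ^+ r.+1 - w ^- r.+1.
have c0 : c != 0.
  rewrite subr_eq0; apply/eqP => h.
  (* Impossible for a primitive root, as 0 < 2 (r + 1) < 2n = N. *)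
  have : w ^+ (2 * r.+1) == 1.
    by rewrite mulnC exprM expr2 {1}h mulVf // expf_neq0 ?omega_neq0.
  by rewrite -(prim_order_dvd omega_prim) {1}hNn dvdn_pmul2l // gtnNdvd.
have -> : lfun_exp (Dop t s) r.+1 (kcol false 'X^(r.+1))
    = c *: lfun_exp (Dop t s) r (kcol false 'X^r).
  rewrite lfun_expSr comp_lfunE Dop_kcol expr0 scale1r -linearZ /=.
  apply/eqP; rewrite -subr_eq0 -linearB /= -kcolZ -scaleN1r -kcolZ -kcolD; apply/eqP.
  apply: DopX_K_space; apply: kcol_mem; apply/leq_sizeP => j rj.
  rewrite scaleN1r coefB coefZ coefXn.
  have [_ h] := size_cheb w r.+1; have [_ hc] := cheb_lead w r.+1.
  rewrite coefXM /= in hc.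
  case: eqP => [->|/eqP jr]; first by rewrite hc mulr1 subrr.
  rewrite mulr0 subr0 nth_default // (leq_trans h) //.
  by rewrite ltn_neqAle eq_sym jr.
move=> /eqP; rewrite scaler_eq0 (negbTE c0) /= => /eqP; apply: IH; exact: ltnW.
Qed.

Lemma K_space_leS m : (Kf m <= Kf m.+1)%VS.
Proof.
rewrite -[X in (X <= _)%VS]lim1g; apply: K_space_img => b k km.
by rewrite id_lfunE; apply: kcol_mono; apply: ltnW.
Qed.

Lemma K_space_flag : flag n Kf.
Proof.
split=> [||r rn]; [exact: K_space0|exact: K_space_full|split; first exact: K_space_leS].
move=> h; apply: (DopX_neq0 rn); apply: DopX_K_space; rewrite h; exact: kcol_mono.
Qed.

(** * The operators T, Lambda and Theta on E + E *)

Local Notation t' := (t^-1)%VF.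
Local Notation T := (T_op R N).
Local Notation L := (Lambda_op N u).
Local Notation S := (S_op R N).
Local Notation V := ('cV[C]_N * 'cV[C]_N)%type.

Lemma t_op_lker0 : lker t == 0%VS.
Proof. exact: cancel_lker0 t_opK. Qed.

Let tK : cancel t t'. Proof. exact: lker0_lfunK t_op_lker0. Qed.
Let t'K : cancel t' t. Proof. exact: lker0_lfunVK t_op_lker0. Qed.

Lemma T_opE (v : V) : T v = (t v.1, t' v.2).
Proof. by rewrite block_lfunE !zero_lfunE addr0 add0r. Qed.

Lemma Lambda_opE (v : V) : L v = (s (v.1 + v.2), - s (v.1 + v.2)).
Proof. by rewrite block_lfunE !opp_lfunE -opprD -linearD. Qed.

Lemma S_opE (v : V) : S v = (v.1 + v.2, - v.1).
Proof. by rewrite block_lfunE opp_lfunE !id_lfunE zero_lfunE addr0. Qed.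

Let S_inv (v : V) : V := (- v.2, v.1 + v.2).

Let S_opK : cancel S S_inv.
Proof. by move=> [x y]; rewrite S_opE /S_inv /= opprK addrAC subrr add0r. Qed.

Let S_invK : cancel S_inv S.
Proof. by move=> [x y]; rewrite S_opE /S_inv /= opprK addrC addrK. Qed.

Lemma S_op_bij : bijective S.
Proof. by exists S_inv. Qed.

Lemma Theta_conj : Theta t = (S^-1 \o (T \o S))%VF.
Proof.
apply/lfunP => v; rewrite !comp_lfunE (lfun_invE S_opK S_invK) T_opE S_opE block_lfunE /=.
rewrite /S_inv /= zero_lfunE addr0 add_lfunE opp_lfunE linearN opprK linearD.
by congr pair; rewrite addrAC.
Qed.

Lemma Xi_conj : Xi s = (S^-1 \o (L \o S))%VF.
Proof.
apply/lfunP => v; rewrite !comp_lfunE (lfun_invE S_opK S_invK) Lambda_opE S_opE block_lfunE /=.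
by rewrite /S_inv /= !zero_lfunE opprK subrr addr0 add0r addrAC subrr add0r.
Qed.

Lemma T_opX k (v : V) : lfun_exp T k v = (lfun_exp t k v.1, lfun_exp t' k v.2).
Proof.
elim: k => [|k IH]; first by rewrite !id_lfunE; case: v.
by rewrite !lfun_expS !comp_lfunE IH T_opE.
Qed.

Lemma T_op_order : lfun_exp T N = \1%VF.
Proof.
apply/lfunP => v; rewrite T_opX t_op_order -[v.2 in LHS](id_lfunE v.2) -t_op_order.
by rewrite lfun_expVK ?t_op_lker0 // t_op_order !id_lfunE; case: v.
Qed.

Lemma Theta_order : lfun_exp (Theta t) N = \1%VF.
Proof.
have SV : lker S == 0%VS := cancel_lker0 S_opK.
have E k : lfun_exp (Theta t) k = (S^-1 \o (lfun_exp T k \o S))%VF.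
  elim: k => [|k IH]; first by rewrite comp_lfun1l lker0_compVf.
  by rewrite lfun_expS IH Theta_conj -!comp_lfunA lker0_compVKf // lfun_expS !comp_lfunA.
by rewrite E T_op_order comp_lfun1l lker0_compVf.
Qed.

Definition fourier (i : 'I_N) : 'cV[C]_N := \col_j w ^+ (i * j).

Lemma fourier_neq0 i : fourier i != 0.
Proof.
apply/eqP => /colP/(_ (Ordinal N_gt0)); rewrite !mxE muln0 => /eqP.
by rewrite oner_eq0.
Qed.

Lemma t_op_fourier i : t (fourier i) = w ^+ i *: fourier i.
Proof.
apply/colP => j; rewrite t_opE !mxE mulnC exprM omega_ordS exprMn -exprM.
by rewrite [(j * i)%N]mulnC.
Qed.

Lemma eigenproj_T_neq0 (i : 'I_N) : eigenproj T w i <> 0.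
Proof.
move=> e0; have : T (fourier i, 0) = w ^+ i *: (fourier i, 0).
  by rewrite T_opE /= linear0 t_op_fourier; congr pair; rewrite scaler0.
move=> /(eigenproj_eigen omega_prim i).
rewrite e0 zero_lfunE eqxx scale1r => /(congr1 fst)/eqP.
by rewrite eq_sym (negbTE (fourier_neq0 i)).
Qed.

Lemma eigenproj_Theta_neq0 (i : 'I_N) : eigenproj (Theta t) w i <> 0.
Proof.
move=> e0; have : Theta t (0, fourier i) = w ^+ i *: (0, fourier i).
  rewrite block_lfunE /= !linear0 !add0r zero_lfunE t_op_fourier.
  by congr pair; rewrite scaler0.
move=> /(eigenproj_eigen omega_prim i).
rewrite e0 zero_lfunE eqxx scale1r => /(congr1 snd)/eqP.
by rewrite eq_sym (negbTE (fourier_neq0 i)).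
Qed.

Lemma cyclic_datum : chebyshev_filtered_datum n t s Kf.
Proof.
split; split=> //; [exact: t_op_bij|exact: s_op_bij|exact: K_space_flag
  |by move=> *; exact: Cop_K_space|by move=> *; exact: Dop_K_space| |].
  move=> D0; apply: (@DopX_neq0 n.-1); last by rewrite D0 zero_lfunE.
  by rewrite prednK // ltnW.
exact: semisimple_root_of_unity omega_prim Theta_order eigenproj_Theta_neq0.
Qed.

(** * A filtration of E + E that Lambda lowers *)

Lemma t_opX_K_space k r e : e \in Kf r.+1 ->
  s (lfun_exp t k e - lfun_exp t' k e) \in Kf r.
Proof.
suff [] : (forall e, e \in Kf r.+1 -> s (lfun_exp t k e - lfun_exp t' k e) \in Kf r) /\
  (forall e, e \in Kf r.+1 -> s (lfun_exp t k.+1 e - lfun_exp t' k.+1 e) \in Kf r).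
  by move=> h _; apply: h.
elim: k => [|k [IH1 IH2]] {e}; split=> // e eK.
- by rewrite subrr linear0 mem0v.
- rewrite !lfun_expS /= !comp_lfun1r.
  have := subvP (Dop_K_space r.+1) _ (memv_img _ eK).
  by rewrite DopE.
- have CK : t e + t' e \in Kf r.+1.
    have := subvP (Cop_K_space r.+1) _ (memv_img _ eK).
    by rewrite CopE.
  have cancel_t : lfun_exp t k.+1 (t' e) = lfun_exp t k e.
    by rewrite lfun_expSr comp_lfunE t'K.
  have cancel_t' : lfun_exp t' k.+1 (t e) = lfun_exp t' k e.
    by rewrite lfun_expSr comp_lfunE tK.
  (* The Chebyshev recursion t^(k+2) - t^-(k+2) = (t^(k+1) - t^-(k+1)) (t + t^-1) - (t^k - t^-k); t
     + t^-1 preserves K_(r+1) by (H1). *)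
  have -> : lfun_exp t k.+2 e - lfun_exp t' k.+2 e =
      (lfun_exp t k.+1 (t e + t' e) - lfun_exp t' k.+1 (t e + t' e))
      - (lfun_exp t k e - lfun_exp t' k e).
    have lfunD f x y : (f : 'End('cV[C]_N)) (x + y) = f x + f y by exact: linearD.
    rewrite !lfunD cancel_t cancel_t'.
    rewrite !(lfun_expSr _ k.+1) !comp_lfunE.
    by apply/colP => i; rewrite !mxE; ring.
  by rewrite linearB; apply: memvB; [apply: IH2 | apply: IH1].
Qed.

(** Up to sign, both components of Lambda T^k v are s (t^k v_1 + t^-k v_2). Asking for all k makes
    stability under T a mere shift of index. *)
Definition filt (r : nat) (v : V) : Prop :=
  if r is r'.+1 then
    forall k, s (lfun_exp t k v.1 + lfun_exp t' k v.2) \in Kf r'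
  else v = 0.

Lemma filt_lin r c a b : filt r a -> filt r b -> filt r (c *: a + b).
Proof.
case: r => [-> ->|r ha hb k] /=; first by rewrite scaler0 addr0.
have -> : lfun_exp t k (c *: a + b).1 + lfun_exp t' k (c *: a + b).2 =
    c *: (lfun_exp t k a.1 + lfun_exp t' k a.2)
    + (lfun_exp t k b.1 + lfun_exp t' k b.2).
  by rewrite /= !linearP /= scalerDr addrACA.
by rewrite linearP; apply: memvD; [apply: memvZ (ha k)|apply: hb].
Qed.

Lemma filt_T r v : filt r v -> filt r (T v).
Proof.
case: r => [->|r hv k] /=; first by rewrite linear0.
by have := hv k.+1; rewrite T_opE !lfun_expSr !comp_lfunE.
Qed.

(** Lambda v = (e, -e) with e = s (v_1 + v_2), so the sum in the condition becomes the difference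
    handled by [t_opX_K_space]. *)
Lemma filt_Lambda r v : filt r.+1 v -> filt r (L v).
Proof.
move=> hv; have := hv 0%N; rewrite !id_lfunE => h0.
rewrite Lambda_opE; case: r hv h0 => [|r] hv h0 /=.
  by move: h0; rewrite K_space0 memv0 => /eqP->; rewrite oppr0.
by move=> k; rewrite linearN; apply: t_opX_K_space.
Qed.

(** Step n + 1 is already everything because K_n = E; this is where the exponent n + 1 comes
    from. *)
Lemma filt_full r v : (n < r)%N -> filt r v.
Proof. by case: r => // r rn k; rewrite K_space_full ?memvf. Qed.

(** * The algebra A, the ideal J and the radical *)

Local Notation A := (generated_algebra [set T; L]).
Local Notation J := (ideal_generated_by A L).

Let A_alg : unital_subalgebra A. Proof. exact: generated_subalgebra. Qed.
Let AT : A T. Proof. by apply: sub_generated; left. Qed.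
Let AL : A L. Proof. by apply: sub_generated; right. Qed.

Lemma filt_leS r v : filt r v -> filt r.+1 v.
Proof.
case: r => [->|r hv] k /=; first by rewrite !linear0 addr0 linear0 mem0v.
exact: subvP (K_space_leS r) _ (hv k).
Qed.

Lemma filt_A a r v : A a -> filt r v -> filt r (a v).
Proof.
move=> Aa; move: r v; pose B : set 'End(V) := [set a | forall r v, filt r v -> filt r (a v)].
apply: (Aa B) => [|b [->|->] r v]; last 2 first.
- exact: filt_T.
- by move/filt_leS; exact: filt_Lambda.
split=> [r v|c b d Bb Bd r v hv|b d Bb Bd r v hv].
- by rewrite id_lfunE.
- by rewrite add_lfunE scale_lfunE; apply: filt_lin; [apply: Bb|apply: Bd].
- by rewrite comp_lfunE; apply: Bb; apply: Bd.
Qed.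

Lemma filt0 r : filt r 0.
Proof. by elim: r => // r; apply: filt_leS. Qed.

Lemma filt_add r a b : filt r a -> filt r b -> filt r (a + b).
Proof. by rewrite -[X in filt r (X + b)]scale1r; apply: filt_lin. Qed.

Lemma filt_J a r v : J a -> filt r.+1 v -> filt r (a v).
Proof.
move=> Ja; move: r v.
pose B : set 'End(V) := [set a | forall r v, filt r.+1 v -> filt r (a v)].
apply: (ideal_generated_by_ind (I := B)) Ja => [r v _|b c Bb Bc r v hv|b c Ab Ac r v hv].
- by rewrite zero_lfunE; apply: filt0.
- by rewrite add_lfunE; apply: filt_add; [apply: Bb|apply: Bc].
- rewrite !comp_lfunE; apply: filt_A => //; apply: filt_Lambda; exact: filt_A.
Qed.

Lemma J_nilpotent a : J a -> lfun_exp a n.+1 = 0.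
Proof.
move=> Ja; have h k r v : filt (r + k) v -> filt r (lfun_exp a k v).
  elim: k r v => [|k IH] r v; first by rewrite addn0 id_lfunE.
  by rewrite addnS => hv; rewrite lfun_expS comp_lfunE; apply: filt_J => //; apply: IH.
by apply/lfunP => v; rewrite zero_lfunE; apply: (h n.+1 0%N); apply: filt_full.
Qed.

Lemma T_expz k : A (lfun_expz T k).
Proof.
case: k => m /=; first exact: (subalgX A_alg m AT).
rewrite (@lfun_exp_inv _ _ _ N.-1) ?prednK ?T_op_order //.
exact: (subalgX A_alg m.+1 (subalgX A_alg N.-1 AT)).
Qed.

(** A word with M exponents has M + 1 factors Lambda, each lowering the filtration by one, while the
    powers of T, negative ones included, lie in A and preserve it. *)
Lemma word_Lambda_T (ks : seq int) : (n <= size ks)%N -> word L T ks = 0.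
Proof.
have h r v : filt (r + size ks).+1 v -> filt r (word L T ks v).
  elim: ks r v => [|k ks IH] r v /=; first by rewrite addn0; apply: filt_Lambda.
  rewrite addnS => hv; rewrite !comp_lfunE; apply: filt_Lambda.
  by apply: filt_A; [apply: T_expz | apply: IH; rewrite addSn].
by move=> nk; apply/lfunP => v; rewrite zero_lfunE; apply: (h 0%N); apply: filt_full.
Qed.

Lemma J_left_ideal : left_ideal A J.
Proof. exact: ideal_generated_by_left_ideal. Qed.

Lemma J_mulr a b : J a -> A b -> J (a \o b)%VF.
Proof. exact: ideal_generated_by_mulr. Qed.

Lemma A_eigenproj_decomp a : A a ->
  exists c : 'I_N -> C, J (a - \sum_i c i *: eigenproj T w i).
Proof.
have B_alg := eigenproj_span_subalg omega_prim T_op_order.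
have BT := eigenproj_span_gen omega_prim T_op_order.
have BA : eigenproj_span T N w `<=` A.
  move=> _ [c ->]; apply: (subalg_sum A_alg) => i; apply: (subalgZ A_alg).
  exact: (eigenproj_subalg _ _ A_alg AT).
move=> Aa; have [|b [->|->]|_ [_ [c ->] Jc]] := Aa [set a | A a /\
    exists2 p, eigenproj_span T N w p & J (a - p)].
- exact: subalg_add_ideal J_left_ideal J_mulr B_alg BA.
- split=> //; exists T => //; rewrite subrr; by case: J_left_ideal.
- split=> //; exists 0; first exact: subalg0 B_alg.
  by rewrite subr0; apply: ideal_generated_by_gen.
- by exists c.
Qed.

Lemma J_Jac : J = Jac A.
Proof.
exact: (Jac_nil_ideal A_alg J_left_ideal J_mulr J_nilpotent
  (fun i => eigenproj_subalg w i A_alg AT) eigenproj_T_neq0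
  (eigenproj_orth omega_prim T_op_order) A_eigenproj_decomp).
Qed.

(** Choose x with s x = x^(n-1), the monomial: Lambda sends (x, 0) to (e, -e) with e this monomial,
    and Lambda T then acts on such pairs as D. *)
Lemma Lambda_T_word_neq0 : (lfun_exp (L \o T) n.-1 \o L)%VF <> 0.
Proof.
have [x sx] : exists x, s x = kcol false 'X^(n.-1).
  by case: s_op_bij => g _ gK; exists (g (kcol false 'X^(n.-1))); exact: gK.
have E k e : lfun_exp (L \o T)%VF k (e, - e)
    = (lfun_exp (Dop t s) k e, - lfun_exp (Dop t s) k e).
  elim: k => [|k IH]; first by rewrite !id_lfunE.
  rewrite !lfun_expS [LHS]comp_lfunE IH [LHS]comp_lfunE T_opE Lambda_opE /=.
  suff DE x' : s (t x' + t' (- x')) = Dop t s x' by rewrite DE [in RHS]comp_lfunE.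
  by rewrite DopE; congr (s (_ + _)); exact: linearN.
move=> /lfunP/(_ (x, 0)); rewrite comp_lfunE Lambda_opE /= addr0 sx E zero_lfunE.
move=> /(congr1 fst) /=; apply: DopX_neq0.
by rewrite prednK // ltnW.
Qed.

(** The nonzero word (Lambda T)^(n-1) Lambda is a product of n elements of J. *)
Lemma ideal_exp_J_neq0 : ideal_exp A J n <> [set 0].
Proof.
have h k : ideal_exp A J k.+1 (lfun_exp (L \o T) k \o L)%VF.
  elim: k => [|k IH]; last first.
    rewrite lfun_expS -comp_lfunA; apply: product_span_mul IH.
    exact: (J_mulr (ideal_generated_by_gen _ A_alg) AT).
  have := product_span_mul (ideal_generated_by_gen L A_alg) (subalg1 A_alg).
  by rewrite comp_lfun1l comp_lfun1r.
move=> J0; apply: Lambda_T_word_neq0.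
by have := h n.-1; rewrite prednK 1?ltnW // J0.
Qed.

Lemma ideal_exp_J_eq0 : ideal_exp A J n.+1 = [set 0].
Proof.
rewrite eqEsubset; split=> [a Ja|_ ->]; last first.
  by exists 0%N, (fun=> 0), (fun=> 0); split=> [[]|[]|] //; rewrite big_ord0.
have h k : ideal_exp A J k `<=` [set a | forall r v, filt (r + k) v -> filt r (a v)].
  elim: k => [|k IH]; first by move=> b Ab r v; rewrite addn0; apply: filt_A.
  apply: product_span_sub => [r v _|b c hb hc r v hv|b c Jb /IH hc r v].
  - by rewrite zero_lfunE; apply: filt0.
  - by rewrite add_lfunE; apply: filt_add; [apply: hb|apply: hc].
  - by rewrite addnS -addSn comp_lfunE => /hc; apply: filt_J.
by apply/lfunP => v; rewrite zero_lfunE; apply: (h n.+1 a Ja 0%N); apply: filt_full.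
Qed.

End CyclicOperators.

Theorem proposition7p4 (R : realType) (N n : nat) (u : R[i])
    (hNn : N = (2 * n)%N) (hN4 : (4 <= N)%N)
    (hu : u != 0) (huN : u ^+ N != 1) :
  let t := @t_op R N in
  let s := s_op N u in
  let T := @T_op R N in
  let Lambda := Lambda_op N u in
  let S := @S_op R N in
  let A := generated_algebra [set T; Lambda] in
  let J := ideal_generated_by A Lambda in
  [/\ chebyshev_filtered_datum n t s (K_space N u n),
      [/\ bijective S,
          Theta t = (S^-1 \o (T \o S))%VF
        & Xi s = (S^-1 \o (Lambda \o S))%VF],
      forall M (k : M.-tuple int), (n <= M)%N -> word Lambda T k = 0,
      (lfun_exp (Lambda \o T) n.-1 \o Lambda)%VF <> 0
    & [/\ J = Jac A, ideal_exp A J n <> [set 0]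
        & ideal_exp A J n.+1 = [set 0]]].
Proof.
move=> t s T L S A J; split.
- exact: cyclic_datum hNn hN4 hu huN.
- split; [exact: S_op_bij|exact: Theta_conj|exact: Xi_conj].
- by move=> M k nM; apply: (word_Lambda_T hNn hN4 hu huN); rewrite size_tuple.
- exact: Lambda_T_word_neq0 hNn hN4 hu huN.
- split; [exact: J_Jac hNn hN4 hu huN|exact: ideal_exp_J_neq0 hNn hN4 hu huN
         |exact: ideal_exp_J_eq0 hNn hN4 hu huN].
Qed.
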